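(* Let $A=M_{n_1}(\mathbb{C})\oplus\cdots\oplus M_{n_k}(\mathbb{C})$ and $B=M_{m_1}(\mathbb{C})\oplus\cdots\oplus M_{m_\ell}(\mathbb{C})$ be finite-dimensional C*-algebras, and let $\varphi\colon A\to B$ be a $*$-homomorphism with multiplicity matrix $E\in M_{\ell\times k}(\mathbb{Z})$. If $\mathrm{K}_0(\varphi)\colon\mathrm{K}_0(A)\to\mathrm{K}_0(B)$ is injective, then so is $\varphi$. If $\varphi$ is surjective, then so is $\mathrm{K}_0(\varphi)$. Moreover, if $\mathrm{K}_0(\varphi)$ is injective, then the following statements are equivalent: (1) the quotient group $\mathrm{K}_0(B)/\mathrm{K}_0(\varphi)(\mathrm{K}_0(A))$ is torsion free; (2) $\gcd\big(\{\det(F)\colon F \text{ is a full square submatrix of } E\}\big)=1$; (3) there exists $K\in M_{k\times \ell}(\mathbb{Z})$ such that $KE=I_k$.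
   Context: The multiplicity matrix of $\varphi$ is the unique $\ell\times k$ matrix $E=(a_{i,j})$ of nonnegative integers for which there is a unitary $\nu=(\nu_1,\ldots,\nu_\ell)\in B$ such that, with $\varphi_i=\pi_i\circ\varphi\colon A\to M_{m_i}(\mathbb{C})$ ($\pi_i$ the projection of $B$ onto its $i$-th summand), for all $1\le i\le \ell$ and $(u_1,\ldots,u_k)\in A$, $$\nu_i\varphi_i(u_1,\ldots,u_k)\nu_i^*=\mathrm{diag}\big(u_1^{(a_{i,1})},u_2^{(a_{i,2})},\ldots,u_k^{(a_{i,k})},0^{(s_i)}\big),$$ where $u^{(a)}$ denotes $a$ block-diagonal copies of $u$, $0^{(s)}$ is the $s\times s$ zero block, and $s_i\ge 0$ is given by $\sum_{j=1}^k a_{i,j}n_j+s_i=m_i$. Under the natural identifications $\mathrm{K}_0(A)\cong\mathbb{Z}^k$ and $\mathrm{K}_0(B)\cong\mathbb{Z}^\ell$ (column vectors), $\mathrm{K}_0(\varphi)(X)=EX$. A full square submatrix of an $\ell\times k$ matrix is a square submatrix with $\min(k,\ell)$ rows. $I_k$ is the $k\times k$ identity matrix. An abelian group $G$ is torsion free if $nx=0$ implies $x=0$ for all $n\in\mathbb{N}=\{1,2,\dots\}$, $x\in G$. *)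

(* Defs.v *)
From HB Require Import structures.
From mathcomp Require Import all_boot all_order all_algebra.
From mathcomp Require Import generic_quotient ring_quotient.
From mathcomp Require Import boolp reals.
From mathcomp Require Import complex.

Set Implicit Arguments.
Unset Strict Implicit.
Unset Printing Implicit Defensive.

Import Order.TTheory GRing.Theory Num.Theory.
Local Open Scope ring_scope.
Local Open Scope quotient_scope.

(* Unital rings with involution.  Everything needed to define K_0 of a unital
   C*-algebra (projections and partial isometries) lives at this level. *)
HB.mixin Record hasStar A of GRing.PzRing A := {
  star : A -> A;
  starK : involutive star;
  starD : {morph star : x y / x + y};
  starM : forall x y : A, star (x * y) = star y * star x
}.

#[short(type="starRingType")]
HB.structure Definition StarRing := {A of GRing.PzRing A & hasStar A}.

(* Not assumed unital. *)
Record starRingHom (A B : starRingType) := StarRingHom {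
  starhom_fun :> A -> B;
  starhomD : {morph starhom_fun : x y / x + y};
  starhomM : {morph starhom_fun : x y / x * y};
  starhom_star : {morph starhom_fun : x / star x}
}.

Definition fdalg (C : numClosedFieldType) (k : nat) (n : 'I_k -> nat) : Type :=
  {dffun forall j : 'I_k, 'M[C]_(n j)}.

Section FdAlg.
Variables (C : numClosedFieldType) (k : nat) (n : 'I_k -> nat).
Local Notation A := (fdalg C n).
Implicit Types (x y z : A).

HB.instance Definition _ := Choice.copy A {dffun forall j : 'I_k, 'M[C]_(n j)}.

Definition fd_mk (f : forall j, 'M[C]_(n j)) : A := finfun f.

Lemma fd_mkE f j : fd_mk f j = f j.
Proof. by rewrite /fd_mk ffunE. Qed.

Lemma fdP x y : (forall j, x j = y j) -> x = y.
Proof. by move=> e; apply/ffunP. Qed.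

Definition fd_zero : A := fd_mk (fun j => 0).
Definition fd_opp x : A := fd_mk (fun j => - x j).
Definition fd_add x y : A := fd_mk (fun j => x j + y j).
Definition fd_one : A := fd_mk (fun j => 1%:M).
Definition fd_mul x y : A := fd_mk (fun j => x j *m y j).
Definition fd_scale (c : C) x : A := fd_mk (fun j => c *: x j).
Definition fd_star x : A := fd_mk (fun j => map_mx Num.conj (x j)^T).

Fact fd_addA : associative fd_add.
Proof. by move=> x y z; apply/fdP => j; rewrite !fd_mkE addrA. Qed.
Fact fd_addC : commutative fd_add.
Proof. by move=> x y; apply/fdP => j; rewrite !fd_mkE addrC. Qed.
Fact fd_add0 : left_id fd_zero fd_add.
Proof. by move=> x; apply/fdP => j; rewrite !fd_mkE add0r. Qed.
Fact fd_addN : left_inverse fd_zero fd_opp fd_add.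
Proof. by move=> x; apply/fdP => j; rewrite !fd_mkE addNr. Qed.
HB.instance Definition _ :=
  GRing.isZmodule.Build A fd_addA fd_addC fd_add0 fd_addN.

Lemma fdD x y j : (x + y) j = x j + y j. Proof. exact: fd_mkE. Qed.

Fact fd_mulA : associative fd_mul.
Proof. by move=> x y z; apply/fdP => j; rewrite !fd_mkE mulmxA. Qed.
Fact fd_mul1 : left_id fd_one fd_mul.
Proof. by move=> x; apply/fdP => j; rewrite !fd_mkE mul1mx. Qed.
Fact fd_mulr1 : right_id fd_one fd_mul.
Proof. by move=> x; apply/fdP => j; rewrite !fd_mkE mulmx1. Qed.
Fact fd_mulDl : left_distributive fd_mul +%R.
Proof. by move=> x y z; apply/fdP => j; rewrite !fd_mkE mulmxDl. Qed.
Fact fd_mulDr : right_distributive fd_mul +%R.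
Proof. by move=> x y z; apply/fdP => j; rewrite !fd_mkE mulmxDr. Qed.
HB.instance Definition _ :=
  GRing.Zmodule_isPzRing.Build A fd_mulA fd_mul1 fd_mulr1 fd_mulDl fd_mulDr.

Lemma fdM x y j : (x * y) j = x j *m y j. Proof. exact: fd_mkE. Qed.

Fact fd_scaleA (a b : C) x : fd_scale a (fd_scale b x) = fd_scale (a * b) x.
Proof. by apply/fdP => j; rewrite !fd_mkE scalerA. Qed.
Fact fd_scale1 : left_id 1 fd_scale.
Proof. by move=> x; apply/fdP => j; rewrite !fd_mkE scale1r. Qed.
Fact fd_scaleDr : right_distributive fd_scale +%R.
Proof. by move=> c x y; apply/fdP => j; rewrite !fd_mkE scalerDr. Qed.
Fact fd_scaleDl x : {morph fd_scale^~ x : a b / a + b}.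
Proof. by move=> a b; apply/fdP => j; rewrite !fd_mkE scalerDl. Qed.
HB.instance Definition _ :=
  GRing.Zmodule_isLmodule.Build C A fd_scaleA fd_scale1 fd_scaleDr fd_scaleDl.

Lemma fdZ (c : C) x j : (c *: x) j = c *: x j. Proof. exact: fd_mkE. Qed.

Fact fd_starK : involutive fd_star.
Proof.
move=> x; apply/fdP => j; rewrite !fd_mkE.
by apply/matrixP => a b; rewrite !mxE conjCK.
Qed.
Fact fd_starD : {morph fd_star : x y / x + y}.
Proof.
move=> x y; apply/fdP => j; rewrite !fd_mkE.
by rewrite linearD map_mxD.
Qed.
Fact fd_starM x y : fd_star (x * y) = fd_star y * fd_star x.
Proof. by apply/fdP => j; rewrite !fd_mkE trmx_mul map_mxM. Qed.
HB.instance Definition _ := hasStar.Build A fd_starK fd_starD fd_starM.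

Lemma fd_starE x j : (star x) j = map_mx Num.conj (x j)^T.
Proof. exact: fd_mkE. Qed.

End FdAlg.

(* [starRingHom] supplies additivity only; linearity over C is added here.  No
   norm appears since *-homomorphisms of C*-algebras are contractive. *)
Record starHom (C : numClosedFieldType) (k l : nat)
    (n : 'I_k -> nat) (m : 'I_l -> nat) := StarHom {
  starhom_ring :> starRingHom (fdalg C n) (fdalg C m);
  starhomZ : forall (c : C) (x : fdalg C n),
    starhom_ring (c *: x) = c *: starhom_ring x
}.

Section Grothendieck.
Variable M : nmodType.
Implicit Types x y : M * M.

(* The pair (a, b) stands for the formal difference [a] - [b]. *)
Definition groth_rel x y : bool :=
  `[< exists c : M, x.1 + y.2 + c = y.1 + x.2 + c >].

Lemma groth_relP x y :
  reflect (exists c, x.1 + y.2 + c = y.1 + x.2 + c) (groth_rel x y).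
Proof. exact: asboolP. Qed.

Fact groth_equiv : equiv_class_of groth_rel.
Proof.
split=> [x|x y|y x z]; first by apply/groth_relP; exists 0.
  by apply/groth_relP/groth_relP => -[c e]; exists c.
move=> /groth_relP[c e1] /groth_relP[d e2]; apply/groth_relP.
exists (y.1 + y.2 + c + d).
have -> : x.1 + z.2 + (y.1 + y.2 + c + d)
        = (x.1 + y.2 + c) + (y.1 + z.2 + d).
  by rewrite !addrA [LHS](AC (1*1*1*1*1*1) (1*4*5*3*2*6)).
by rewrite e1 e2 !addrA [LHS](AC (1*1*1*1*1*1) (4*2*1*5*3*6)).
Qed.

Canonical groth_equiv_rel := EquivRelPack groth_equiv.
Canonical groth_encModRel := defaultEncModRel groth_rel.

Definition grothendieck := {eq_quot groth_rel}.
HB.instance Definition _ : EqQuotient _ groth_rel grothendieck :=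
  EqQuotient.on grothendieck.
HB.instance Definition _ := Choice.on grothendieck.

Definition groth (x : M * M) : grothendieck := \pi_grothendieck x.

Lemma groth_eq x y :
  groth x = groth y <-> exists c, x.1 + y.2 + c = y.1 + x.2 + c.
Proof.
by split=> [/eqmodP/groth_relP|e]; [|apply/eqmodP/groth_relP].
Qed.

Lemma groth_repr (X : grothendieck) : groth (repr X) = X.
Proof. exact: reprK. Qed.

Definition groth_zero : grothendieck := groth (0, 0).
Definition groth_opp (X : grothendieck) : grothendieck :=
  groth ((repr X).2, (repr X).1).
Definition groth_add (X Y : grothendieck) : grothendieck :=
  groth ((repr X).1 + (repr Y).1, (repr X).2 + (repr Y).2).

Lemma groth_addE x y :
  groth_add (groth x) (groth y) = groth (x.1 + y.1, x.2 + y.2).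
Proof.
have /groth_eq [c ec] := groth_repr (groth x).
have /groth_eq[d ed] := groth_repr (groth y).
apply/groth_eq; exists (c + d) => /=; move: ec ed.
case: (repr (groth x)) => a b /=; case: (repr (groth y)) => a' b' /= ec ed.
have -> : a + a' + (x.2 + y.2) + (c + d) = (a + x.2 + c) + (a' + y.2 + d).
  by rewrite !addrA [LHS](AC (1*1*1*1*1*1) (1*3*5*2*4*6)).
by rewrite ec ed !addrA [LHS](AC (1*1*1*1*1*1) (1*4*2*5*3*6)).
Qed.

Lemma groth_oppE x : groth_opp (groth x) = groth (x.2, x.1).
Proof.
have /groth_eq [c ec] := groth_repr (groth x).
apply/groth_eq; exists c => /=.
by rewrite [_ + x.1]addrC [x.2 + _]addrC ec.
Qed.

Fact groth_addA : associative groth_add.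
Proof.
move=> X Y Z; rewrite -(groth_repr X) -(groth_repr Y) -(groth_repr Z).
by rewrite !groth_addE /= !addrA.
Qed.
Fact groth_addC : commutative groth_add.
Proof.
move=> X Y; rewrite -(groth_repr X) -(groth_repr Y) !groth_addE.
by congr (groth (_, _)); rewrite addrC.
Qed.
Fact groth_add0 : left_id groth_zero groth_add.
Proof.
move=> X; rewrite -(groth_repr X) groth_addE /= !add0r.
by case: (repr X).
Qed.
Fact groth_addN : left_inverse groth_zero groth_opp groth_add.
Proof.
move=> X; rewrite -(groth_repr X) groth_oppE groth_addE.
by apply/groth_eq; exists 0; rewrite /= !addr0 add0r addrC.
Qed.
HB.instance Definition _ := GRing.isZmodule.Build grothendieck
  groth_addA groth_addC groth_add0 groth_addN.

Lemma grothD x y : groth x + groth y = groth (x.1 + y.1, x.2 + y.2).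
Proof. exact: groth_addE. Qed.
Lemma grothN x : - groth x = groth (x.2, x.1).
Proof. exact: groth_oppE. Qed.

End Grothendieck.

Section GrothendieckMap.
Variables (M N : nmodType) (f : {additive M -> N}).

Definition groth_map (X : grothendieck M) : grothendieck N :=
  groth (f (repr X).1, f (repr X).2).

Lemma groth_mapE x : groth_map (groth x) = groth (f x.1, f x.2).
Proof.
have /groth_eq [c ec] := groth_repr (groth x).
by apply/groth_eq; exists (f c); rewrite /= -!raddfD ec.
Qed.

Fact groth_map_zmod_morphism : zmod_morphism groth_map.
Proof.
move=> X Y; rewrite -(groth_repr X) -(groth_repr Y).
by rewrite grothN grothD !groth_mapE grothN grothD /= !raddfD.
Qed.
HB.instance Definition _ := GRing.isZmodMorphism.Build
  (grothendieck M) (grothendieck N) groth_map groth_map_zmod_morphism.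

End GrothendieckMap.

Section Projections.
Variable A : starRingType.

Definition adjmx m n (X : 'M[A]_(m, n)) : 'M[A]_(n, m) := map_mx star X^T.

Fact star0 : star (0 : A) = 0.
Proof. by apply: (@addrI _ (star 0)); rewrite -starD !addr0. Qed.

Lemma star_sum I (r : seq I) (F : I -> A) :
  star (\sum_(i <- r) F i) = \sum_(i <- r) star (F i).
Proof. by apply: big_morph; [exact: starD | exact: star0]. Qed.

Lemma adjmxK m n (X : 'M[A]_(m, n)) : adjmx (adjmx X) = X.
Proof. by apply/matrixP => i j; rewrite !mxE starK. Qed.

Lemma adjmxM m n p (X : 'M[A]_(m, n)) (Y : 'M[A]_(n, p)) :
  adjmx (X *m Y) = adjmx Y *m adjmx X.
Proof.
apply/matrixP => i j; rewrite !mxE star_sum.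
by apply: eq_bigr => h _; rewrite !mxE starM.
Qed.

Lemma adjmx0 m n : adjmx (0 : 'M[A]_(m, n)) = 0.
Proof. by apply/matrixP => i j; rewrite !mxE star0. Qed.

Lemma adjmx_block m1 m2 n1 n2 (X : 'M[A]_(m1, n1)) (Y : 'M[A]_(m1, n2))
    (Z : 'M[A]_(m2, n1)) (T : 'M[A]_(m2, n2)) :
  adjmx (block_mx X Y Z T)
  = block_mx (adjmx X) (adjmx Z) (adjmx Y) (adjmx T).
Proof. by rewrite /adjmx tr_block_mx map_block_mx. Qed.

Definition is_projmx n (p : 'M[A]_n) : bool :=
  (p *m p == p) && (adjmx p == p).

Record proj := Proj {
  proj_val :> {N : nat & 'M[A]_N};
  _ : is_projmx (tagged proj_val)
}.
HB.instance Definition _ := [isSub for proj_val].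
HB.instance Definition _ := [Choice of proj by <:].

Definition psize (p : proj) : nat := tag (val p).
Definition pmx (p : proj) : 'M[A]_(psize p) := tagged (val p).

Lemma pmx_idem p : pmx p *m pmx p = pmx p.
Proof. by case: p => -[N p] hp; case/andP: (hp) => /eqP. Qed.
Lemma pmx_adj p : adjmx (pmx p) = pmx p.
Proof. by case: p => -[N p] hp; case/andP: (hp) => _ /eqP. Qed.

Definition mkproj N (p : 'M[A]_N) (hp : is_projmx p) : proj :=
  @Proj (Tagged (fun N => 'M[A]_N) p) hp.

(* The partial isometry is rectangular, so p and q may have different sizes. *)
Definition mvn_mx m n (p : 'M[A]_m) (q : 'M[A]_n) : Prop :=
  exists v : 'M[A]_(n, m), adjmx v *m v = p /\ v *m adjmx v = q.

Definition mvn (p q : proj) : bool := `[< mvn_mx (pmx p) (pmx q) >].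

Lemma mvnP p q : reflect (mvn_mx (pmx p) (pmx q)) (mvn p q).
Proof. exact: asboolP. Qed.

Fact mvn_equiv : equiv_class_of mvn.
Proof.
split=> [p|p q|q p r].
- by apply/mvnP; exists (pmx p); rewrite pmx_adj pmx_idem.
- by apply/mvnP/mvnP => -[v [e1 e2]]; exists (adjmx v); rewrite adjmxK.
move=> /mvnP[v [v1 v2]] /mvnP[w [w1 w2]]; apply/mvnP; exists (w *m v).
rewrite adjmxM; split.
  rewrite mulmxA -(mulmxA (adjmx v)) w1 -v2 !mulmxA v1 -mulmxA v1.
  exact: pmx_idem.
rewrite mulmxA -(mulmxA w) v2 -w1 !mulmxA w2 -mulmxA w2.
exact: pmx_idem.
Qed.

Canonical mvn_equiv_rel := EquivRelPack mvn_equiv.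
Canonical mvn_encModRel := defaultEncModRel mvn.

Definition mvn_classes := {eq_quot mvn}.
HB.instance Definition _ : EqQuotient _ mvn mvn_classes :=
  EqQuotient.on mvn_classes.
HB.instance Definition _ := Choice.on mvn_classes.

Definition mvn_class (p : proj) : mvn_classes := \pi_mvn_classes p.

Lemma mvn_class_eq p q :
  mvn_class p = mvn_class q <-> mvn_mx (pmx p) (pmx q).
Proof. by split=> [e|e]; [apply/mvnP; exact/eqmodP | apply/eqmodP/mvnP]. Qed.

Lemma mvn_class_repr (X : mvn_classes) : mvn_class (repr X) = X.
Proof. exact: reprK. Qed.

Fact proj0_subproof : is_projmx (0 : 'M[A]_0).
Proof. by rewrite /is_projmx mul0mx adjmx0 !eqxx. Qed.
Definition proj0 : proj := mkproj proj0_subproof.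

Fact proj_add_subproof (p q : proj) : is_projmx (block_mx (pmx p) 0 0 (pmx q)).
Proof.
rewrite /is_projmx adjmx_block mulmx_block !mul0mx !mulmx0 !addr0 !add0r.
by rewrite !pmx_idem !pmx_adj !adjmx0 !eqxx.
Qed.
Definition proj_add (p q : proj) : proj := mkproj (proj_add_subproof p q).

Definition mvn_add (X Y : mvn_classes) : mvn_classes :=
  mvn_class (proj_add (repr X) (repr Y)).

Lemma mvn_addE p q :
  mvn_add (mvn_class p) (mvn_class q) = mvn_class (proj_add p q).
Proof.
have /mvn_class_eq[v [v1 v2]] := mvn_class_repr (mvn_class p).
have /mvn_class_eq[w [w1 w2]] := mvn_class_repr (mvn_class q).
apply/mvn_class_eq; exists (block_mx v 0 0 w).
rewrite adjmx_block !mulmx_block !adjmx0 !mul0mx !mulmx0 !addr0 !add0r.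
by rewrite v1 v2 w1 w2.
Qed.

Fact mvn_addA : associative mvn_add.
Proof.
move=> X Y Z.
rewrite -(mvn_class_repr X) -(mvn_class_repr Y) -(mvn_class_repr Z).
move: (repr X) (repr Y) (repr Z) => p q r; rewrite !mvn_addE.
apply/mvn_class_eq; rewrite /mvn_mx /pmx /psize /=.
rewrite -/(pmx p) -/(pmx q) -/(pmx r).
have := block_mxA (A11 := pmx p) (A12 := 0) (A13 := 0) (A21 := 0)
  (A22 := pmx q) (A23 := 0) (A31 := 0) (A32 := 0) (A33 := pmx r).
rewrite /= !row_mx0 !col_mx0 => e.
have castP m (x : 'M[A]_m) m' (eqm : m = m') :
    is_projmx x -> mvn_mx (castmx (eqm, eqm) x) x.
  by case: m' / eqm => /andP[/eqP h1 /eqP h2]; exists x; rewrite castmx_id h2 h1.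
have := castP _ _ _ (esym (addnA _ _ _))
  (proj_add_subproof (proj_add p q) r).
by rewrite -e.
Qed.

Fact mvn_addC : commutative mvn_add.
Proof.
move=> X Y; rewrite -(mvn_class_repr X) -(mvn_class_repr Y) !mvn_addE.
apply/mvn_class_eq; exists (block_mx 0 (pmx (repr Y)) (pmx (repr X)) 0).
rewrite adjmx_block !mulmx_block !adjmx0 !mul0mx !mulmx0 !addr0 !add0r.
by rewrite !pmx_adj !pmx_idem.
Qed.

Fact mvn_add0 : left_id (mvn_class proj0) mvn_add.
Proof.
move=> X; rewrite -(mvn_class_repr X) mvn_addE.
apply/mvn_class_eq; exists (row_mx 0 (pmx (repr X))).
rewrite /adjmx tr_row_mx map_col_mx -!/(adjmx _) mul_col_row mul_row_col.
rewrite !adjmx0 !mul0mx !mulmx0 add0r pmx_adj pmx_idem; split=> //.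
Qed.
HB.instance Definition _ := GRing.isNmodule.Build mvn_classes
  mvn_addA mvn_addC mvn_add0.

Lemma mvn_class0 : mvn_class proj0 = 0. Proof. by []. Qed.
Lemma mvn_classD p q : mvn_class p + mvn_class q = mvn_class (proj_add p q).
Proof. exact: mvn_addE. Qed.

(* For unital [A], K_0(A) is the Grothendieck group of the monoid of
   Murray-von Neumann classes; it only depends on the *-ring structure. *)
Definition K0 := grothendieck mvn_classes.
HB.instance Definition _ := GRing.Zmodule.on K0.

End Projections.

Section K0Map.
Variables (A B : starRingType) (phi : starRingHom A B).

Lemma starhom0 : phi 0 = 0.
Proof. by apply: (@addrI _ (phi 0)); rewrite -starhomD !addr0. Qed.

Lemma map_starhomM m n p (X : 'M[A]_(m, n)) (Y : 'M[A]_(n, p)) :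
  map_mx phi (X *m Y) = map_mx phi X *m map_mx phi Y.
Proof.
apply/matrixP => i j; rewrite !mxE (big_morph _ (starhomD phi) starhom0).
by apply: eq_bigr => h _; rewrite !mxE starhomM.
Qed.

Lemma map_starhom_adj m n (X : 'M[A]_(m, n)) :
  map_mx phi (adjmx X) = adjmx (map_mx phi X).
Proof. by apply/matrixP => i j; rewrite !mxE starhom_star. Qed.

Lemma map_starhom0 m n : map_mx phi (0 : 'M[A]_(m, n)) = 0.
Proof. by apply/matrixP => i j; rewrite !mxE starhom0. Qed.

Fact proj_map_subproof (p : proj A) : is_projmx (map_mx phi (pmx p)).
Proof.
by rewrite /is_projmx -map_starhomM -map_starhom_adj pmx_idem pmx_adj !eqxx.
Qed.
Definition proj_map (p : proj A) : proj B := mkproj (proj_map_subproof p).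

Definition mvn_map (X : mvn_classes A) : mvn_classes B :=
  mvn_class (proj_map (repr X)).

Lemma mvn_mapE p : mvn_map (mvn_class p) = mvn_class (proj_map p).
Proof.
have /mvn_class_eq[v [v1 v2]] := mvn_class_repr (mvn_class p).
apply/mvn_class_eq; exists (map_mx phi v).
by rewrite -map_starhom_adj -!map_starhomM v1 v2.
Qed.

Fact mvn_map_nmod_morphism : nmod_morphism mvn_map.
Proof.
split=> [|X Y].
  rewrite -mvn_class0 mvn_mapE; apply/mvn_class_eq; exists 0.
  rewrite mulmx0 mul0mx; split; last by rewrite [LHS]flatmx0 [RHS]flatmx0.
  by rewrite [LHS]flatmx0 [RHS]flatmx0.
rewrite -(mvn_class_repr X) -(mvn_class_repr Y) mvn_classD !mvn_mapE mvn_classD.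
congr mvn_class; apply: val_inj; congr (Tagged _ _).
by rewrite [LHS]map_block_mx !map_starhom0.
Qed.
HB.instance Definition _ := GRing.isNmodMorphism.Build
  (mvn_classes A) (mvn_classes B) mvn_map mvn_map_nmod_morphism.

Definition K0_map : K0 A -> K0 B := groth_map mvn_map.
HB.instance Definition _ := GRing.Additive.on K0_map.

Definition K0_image : {pred K0 B} := fun y => `[< exists x, K0_map x = y >].

Fact K0_image_zmod_closed : zmod_closed K0_image.
Proof.
split; first by apply/asboolP; exists 0; rewrite raddf0.
move=> _ _ /asboolP[x <-] /asboolP[y <-]; apply/asboolP.
by exists (x - y); rewrite raddfB.
Qed.
HB.instance Definition _ := GRing.isZmodClosed.Build _ K0_image
  K0_image_zmod_closed.

Definition K0_coker : zmodType := Quotient.quot K0_image.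

End K0Map.

Definition torsion_free (G : zmodType) : Prop :=
  forall (n : nat) (x : G), (0 < n)%N -> x *+ n = 0 -> x = 0.

(* diag(u_1^(a_1), ..., u_k^(a_k), 0^(s)), each u_j^(a_j) being a nested block
   diagonal matrix. *)
Definition multdiag (C : numClosedFieldType) (k : nat) (n : 'I_k -> nat)
    (a : 'I_k -> nat) (s : nat) (u : fdalg C n) :
    'M[C]_(\sum_(j < k) \sum_(p < a j) n j + s) :=
  block_mx (\mxdiag_(j < k) \mxdiag_(p < a j) u j) 0 0 (0 : 'M[C]_s).

Definition is_multiplicity_matrix (C : numClosedFieldType) (k l : nat)
    (n : 'I_k -> nat) (m : 'I_l -> nat)
    (phi : starHom C n m) (E : 'M[nat]_(l, k)) : Prop :=
  exists (nu : fdalg C m) (s : 'I_l -> nat)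
    (es : forall i, (\sum_(j < k) \sum_(p < E i j) n j + s i)%N = m i),
    [/\ nu * star nu = 1, star nu * nu = 1
      & forall (i : 'I_l) (u : fdalg C n),
          nu i *m phi u i *m (star nu) i
          = castmx (es i, es i) (multdiag (E i) (s i) u)].

Definition increasing (r n : nat) (f : {ffun 'I_r -> 'I_n}) : bool :=
  [forall a : 'I_r, forall b : 'I_r, (a < b)%N ==> (f a < f b)%N].

(* A submatrix is given by increasing enumerations of its rows and columns;
   [gcdz] is nonnegative. *)
Definition full_minors_gcd (l k : nat) (E : 'M[int]_(l, k)) : int :=
  \big[gcdz/0]_(f : {ffun 'I_(minn k l) -> 'I_l} | increasing f)
    \big[gcdz/0]_(g : {ffun 'I_(minn k l) -> 'I_k} | increasing g)
      \det (mxsub f g E).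

(* Main.v *)
Require Import Defs.
From HB Require Import structures.
From mathcomp Require Import all_boot all_order all_algebra all_fingroup.
From mathcomp Require Import generic_quotient ring_quotient.
From mathcomp Require Import boolp reals complex.

(* Over M_n(C) a projection is, up to Murray-von Neumann equivalence, its rank,
   and the rank of a projection is its trace.  Hence the ranks of the summands
   identify K_0(A) with Z^k, and the trace formula
   tr (phi(u)_i) = sum_j E_ij tr(u_j) shows that K_0(phi) is the matrix E.
   Injectivity of E forces every column of E to be nonzero, whence phi is
   faithful by the same formula.  If phi is onto and p is a minimal projection
   in summand j of A, then phi(p) B phi(p) = C phi(p), so the coordinates of
   phi(p) have rank at most 1 and at most one of them is nonzero: each column
   of E is zero or a standard basis vector, and no row of E is zero.
   The equivalences are about integer matrices: a torsion free cokernel makes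
   the elementary divisors in the Smith form units, which gives a left inverse;
   a left inverse survives reduction modulo any prime, so no prime divides all
   maximal minors; and if those are coprime, combining the adjugates of the
   maximal square submatrices by Bezout gives a left inverse. *)

Set Implicit Arguments.
Unset Strict Implicit.
Unset Printing Implicit Defensive.

Import Order.TTheory GRing.Theory Num.Theory.
Local Open Scope ring_scope.
Local Open Scope sesquilinear_scope.

Lemma delta_mxMM (R : comNzRingType) m n p q (X : 'M[R]_(n, p))
    (a : 'I_m) b c (d : 'I_q) :
  delta_mx a b *m X *m delta_mx c d = X b c *: delta_mx a d.
Proof.
rewrite -(mul_delta_mx (0 : 'I_1) a b) -(mul_delta_mx (0 : 'I_1) c d).
rewrite -(mulmxA (delta_mx a 0)) -rowE mulmxA -(mulmxA _ (row b X)) -colE.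
rewrite [col c _]mx11_scalar !mxE.
by rewrite mul_mx_scalar -scalemxAl mul_delta_mx.
Qed.

(** * Projections over [C]: rank, trace and orthonormal factorization *)

Section ComplexProjections.
Variable C : numClosedFieldType.

(** Gram-Schmidt applied to a row basis of [P] makes the rows of [W] an orthonormal basis of the row
    space of [P]. *)
Lemma projmx_factor N (P : 'M[C]_N) r :
    P *m P = P -> P ^t* = P -> \rank P = r ->
  exists2 W : 'M[C]_(r, N), W *m W ^t* = 1%:M & W ^t* *m W = P.
Proof.
move=> PP PH <-; pose W := schmidt (row_base P).
have WW : W *m W ^t* = 1%:M.
  by apply/unitarymxP/schmidt_unitarymx/rank_leq_col.
have eW : (W :=: P)%MS.
  apply: eqmx_trans (eq_row_base P).
  by apply: eqmx_schmidt_free; rewrite row_base_free.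
have /submxP[D eD] : (P <= W)%MS by rewrite eW.
have WP : W *m P = W.
  have /submxP[D' ->] : (W <= P)%MS by rewrite eW.
  by rewrite -mulmxA PP.
exists W => //.
have e : P = W ^t* *m D ^t* by rewrite -map_mxM -trmx_mul -eD PH.
rewrite -[X in _ *m X]WP mulmxA [X in _ *m X = _]e mulmxA.
by rewrite -(mulmxA _ W) WW mulmx1 -e.
Qed.

Lemma projmx_trace N (P : 'M[C]_N) : P *m P = P -> P ^t* = P ->
  \tr P = (\rank P)%:R.
Proof.
move=> PP PH; have [W WW eP] := projmx_factor PP PH erefl; rewrite -[in LHS]eP.
by rewrite mxtrace_mulC WW mxtrace1.
Qed.

End ComplexProjections.

(** * Matrices over [A] as families of complex block matrices *)

Section Flatten.
Variables (C : numClosedFieldType) (k : nat) (n : 'I_k -> nat).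
Local Notation A := (fdalg C n).

(** Coordinate [j] of the *-isomorphism between [M_N(A)] and the sum of the [M_(N n_j)(C)], in
    rectangular form. *)
Definition flatmx j M N (X : 'M[A]_(M, N)) :
    'M[C]_(\sum_(a < M) n j, \sum_(b < N) n j) :=
  \mxblock_(a < M, b < N) (X a b : A) j.

Lemma fd0 j : (0 : A) j = 0. Proof. exact: fd_mkE. Qed.

Lemma fd1 j : (1 : A) j = 1%:M. Proof. exact: fd_mkE. Qed.

Lemma fd_sum j I (r : seq I) (P : pred I) (F : I -> A) :
  (\sum_(i <- r | P i) F i) j = \sum_(i <- r | P i) F i j.
Proof.
by apply: (big_morph (fun x : A => x j)) => [x y|]; rewrite ?fdD ?fd0.
Qed.

Lemma flatmxM j M N P (X : 'M[A]_(M, N)) (Y : 'M[A]_(N, P)) :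
  flatmx j (X *m Y) = flatmx j X *m flatmx j Y.
Proof.
rewrite mul_mxblock; apply: eq_mxblock => a b; rewrite mxE fd_sum.
by apply: eq_bigr => c _; rewrite fdM.
Qed.

Lemma flatmx_adj j M N (X : 'M[A]_(M, N)) :
  flatmx j (adjmx X) = (flatmx j X) ^t*.
Proof.
by apply/matrixP => s t; rewrite !mxE fd_starE !mxE.
Qed.

Lemma flatmx_inj M N (X Y : 'M[A]_(M, N)) :
  (forall j, flatmx j X = flatmx j Y) -> X = Y.
Proof.
move=> e; apply/matrixP => a b; apply/fdP => j.
by have /mxblockP/(_ a b) := e j; rewrite !mxblockK.
Qed.

Lemma flatmx_surj M N
    (Z : forall j, 'M[C]_(\sum_(a < M) n j, \sum_(b < N) n j)) :
  exists X : 'M[A]_(M, N), forall j, flatmx j X = Z j.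
Proof.
exists (\matrix_(a, b) fd_mk (fun j => submxblock (Z j) a b)) => j.
rewrite -[RHS]submxblockK; apply: eq_mxblock => a b.
by rewrite mxE fd_mkE.
Qed.

Lemma mxtrace_flat j N (X : 'M[A]_N) :
  \tr (flatmx j X) = \sum_a \tr ((X a a : A) j).
Proof. exact: mxtrace_mxblock. Qed.

Definition pdim (p : proj A) (j : 'I_k) : nat := \rank (flatmx j (pmx p)).

Lemma flat_pmx_idem j (p : proj A) :
  flatmx j (pmx p) *m flatmx j (pmx p) = flatmx j (pmx p).
Proof. by rewrite -flatmxM pmx_idem. Qed.

Lemma flat_pmx_adj j (p : proj A) : (flatmx j (pmx p)) ^t* = flatmx j (pmx p).
Proof. by rewrite -flatmx_adj pmx_adj. Qed.

Lemma pdim_trace (p : proj A) j :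
  (pdim p j)%:R = \sum_a \tr ((pmx p a a : A) j) :> C.
Proof.
rewrite -mxtrace_flat.
by rewrite projmx_trace ?flat_pmx_idem ?flat_pmx_adj.
Qed.

(** Forward, [v* v] and [v v*] have equal traces, hence equal ranks. Conversely, if [V] and [W]
    factor two projections of the same rank, [W ^t* V] is a partial isometry between them; these are
    built in each summand and glued by [flatmx_surj]. *)
Lemma mvn_pdim (p q : proj A) : mvn_mx (pmx p) (pmx q) <-> pdim p =1 pdim q.
Proof.
split=> [[v [vp vq]] j|e].
  apply/eqP; rewrite -(eqr_nat C) !pdim_trace -!mxtrace_flat -vp -vq.
  by rewrite !flatmxM mxtrace_mulC.
suff hZ j : exists z : 'M[C]_(_, _),
    z ^t* *m z = flatmx j (pmx p) /\ z *m z ^t* = flatmx j (pmx q).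
  have [v hv] := flatmx_surj (fun j => sval (cid (hZ j))).
  by exists v; split; apply: flatmx_inj => j;
    rewrite flatmxM flatmx_adj hv; case: (svalP (cid (hZ j))).
have [V VV eV] := projmx_factor (flat_pmx_idem j p) (flat_pmx_adj j p) erefl.
have [W WW eW] :=
  projmx_factor (flat_pmx_idem j q) (flat_pmx_adj j q) (esym (e j)).
exists (W ^t* *m V); rewrite trmx_mul map_mxM trmxCK; split.
  by rewrite mulmxA -(mulmxA _ W) WW mulmx1.
by rewrite mulmxA -(mulmxA _ V) VV mulmx1.
Qed.

End Flatten.

(** * The rank vector embeds K_0(A) into Z^k *)

Section K0dim.
Variables (C : numClosedFieldType) (k : nat) (n : 'I_k -> nat).
Local Notation A := (fdalg C n).

Definition mvn_dim (x : mvn_classes A) : 'cV[int]_k :=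
  \col_j Posz (pdim (repr x) j).

Lemma mvn_dimE (p : proj A) : mvn_dim (mvn_class p) = \col_j Posz (pdim p j).
Proof.
have /mvn_class_eq/mvn_pdim e := mvn_class_repr (mvn_class p).
by apply/matrixP => j c; rewrite !mxE e.
Qed.

Lemma mvn_dim_inj : injective mvn_dim.
Proof.
move=> x y; rewrite -(mvn_class_repr x) -(mvn_class_repr y) !mvn_dimE => e.
apply/mvn_class_eq/mvn_pdim => j.
by have /matrixP/(_ j 0) := e; rewrite !mxE => -[].
Qed.

Lemma pdim_add (p q : proj A) j :
  pdim (proj_add p q) j = (pdim p j + pdim q j)%N.
Proof.
apply/eqP; rewrite -(eqr_nat C) natrD !pdim_trace /=.
rewrite big_split_ord /=; apply/eqP; congr (_ + _); apply: eq_bigr => a _.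
  by rewrite /pmx /= block_mxEul.
by rewrite /pmx /= block_mxEdr.
Qed.

Fact mvn_dim_nmod_morphism : nmod_morphism mvn_dim.
Proof.
split=> [|x y].
  rewrite -mvn_class0 mvn_dimE; apply/matrixP => j c; rewrite !mxE.
  congr Posz; apply/eqP; rewrite -(eqr_nat C) pdim_trace.
  by rewrite big_ord0.
rewrite -(mvn_class_repr x) -(mvn_class_repr y) mvn_classD !mvn_dimE.
by apply/matrixP => j c; rewrite !mxE pdim_add.
Qed.
HB.instance Definition _ := GRing.isNmodMorphism.Build
  (mvn_classes A) 'cV[int]_k mvn_dim mvn_dim_nmod_morphism.

Definition K0_dim (X : K0 A) : 'cV[int]_k :=
  mvn_dim (repr X).1 - mvn_dim (repr X).2.

Lemma K0_dimE x y : K0_dim (groth (x, y)) = mvn_dim x - mvn_dim y.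
Proof.
have /groth_eq[c /= e] := groth_repr (groth (x, y)).
apply/eqP; rewrite subr_eq addrAC eq_sym subr_eq.
(* Equal formal differences agree only after adding some class [c], whose rank vector cancels in
   Z^k. *)
apply/eqP/(addIr (mvn_dim c)); rewrite -!raddfD /=.
by rewrite e.
Qed.

Fact K0_dim_zmod_morphism : zmod_morphism K0_dim.
Proof.
move=> X Y; rewrite -(groth_repr X) -(groth_repr Y).
case: (repr X) (repr Y) => [a b] [c d].
rewrite grothN grothD /= !K0_dimE !raddfD /=.
by rewrite opprK [X in _ = _ + X]addrC addrACA.
Qed.
HB.instance Definition _ := GRing.isZmodMorphism.Build
  (K0 A) 'cV[int]_k K0_dim K0_dim_zmod_morphism.

Lemma K0_dim_inj : injective K0_dim.
Proof.
apply: raddf_inj => X; rewrite -(groth_repr X).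
case: (repr X) => a b; rewrite /= K0_dimE => /eqP; rewrite subr_eq0 => /eqP.
move/mvn_dim_inj => ->; apply: (proj2 (groth_eq (b, b) (0, 0))).
by exists 0; rewrite /= !addr0 add0r.
Qed.

End K0dim.

(** * Elements supported in one summand; the rank vector is onto Z^k *)

Section Blocks.
Variables (C : numClosedFieldType) (k : nat) (n : 'I_k -> nat).
Local Notation A := (fdalg C n).

(** The test [i == j] does not identify the types of matrices of sizes [n i] and [n j]; [conform_mx]
    performs the cast, and its default [0] is never reached. *)
Definition fd_block j (x : 'M[C]_(n j)) : A :=
  fd_mk (fun i => if i == j then conform_mx 0 x else 0).

Lemma fd_block_id j (x : 'M[C]_(n j)) : fd_block x j = x.
Proof. by rewrite fd_mkE eqxx conform_mx_id. Qed.

Lemma fd_block_neq j (x : 'M[C]_(n j)) i : i != j -> fd_block x i = 0.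
Proof. by rewrite fd_mkE => /negPf ->. Qed.

Lemma fd_block_ext j (x : 'M[C]_(n j)) (y : A) :
  y j = x -> (forall i, i != j -> y i = 0) -> y = fd_block x.
Proof.
move=> e0 e1; apply/fdP => i; have [->|ij] := eqVneq i j.
  by rewrite fd_block_id.
by rewrite fd_block_neq ?e1.
Qed.

Lemma fd_blockMr j (x : 'M[C]_(n j)) (y : A) :
  fd_block x * y = fd_block (x *m y j).
Proof.
apply: fd_block_ext => [|i ij]; rewrite fdM ?fd_block_id //.
by rewrite fd_block_neq ?mul0mx.
Qed.

Lemma fd_blockM j (x y : 'M[C]_(n j)) :
  fd_block x * fd_block y = fd_block (x *m y).
Proof. by rewrite fd_blockMr fd_block_id. Qed.

Lemma fd_blockZ j (c : C) (x : 'M[C]_(n j)) :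
  fd_block (c *: x) = c *: fd_block x.
Proof.
apply/esym/fd_block_ext => [|i ij]; rewrite fdZ ?fd_block_id //.
by rewrite fd_block_neq ?scaler0.
Qed.

Lemma star_fd_block j (x : 'M[C]_(n j)) : star (fd_block x) = fd_block (x ^t*).
Proof.
apply: fd_block_ext => [|i ij]; rewrite fd_starE ?fd_block_id //.
by rewrite fd_block_neq ?trmx0 ?map_mx0.
Qed.

Hypothesis n_gt0 : forall j, (0 < n j)%N.

Definition min_proj j : A :=
  fd_block (delta_mx (Ordinal (n_gt0 j)) (Ordinal (n_gt0 j))).

Lemma min_projMM j (u : A) :
  min_proj j * u * min_proj j
  = u j (Ordinal (n_gt0 j)) (Ordinal (n_gt0 j)) *: min_proj j.
Proof.
by rewrite fd_blockMr fd_blockM -fd_blockZ delta_mxMM.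
Qed.

Lemma min_proj_trace j i : \tr (min_proj j i) = (i == j)%:R.
Proof.
have [->|ij] := eqVneq i j; last by rewrite fd_block_neq // mxtrace0.
rewrite fd_block_id /mxtrace (bigD1 (Ordinal (n_gt0 j))) //= mxE !eqxx.
rewrite big1 ?addr0 //.
by move=> a /negPf; rewrite mxE => ->.
Qed.

Lemma min_proj_idem j : min_proj j * min_proj j = min_proj j.
Proof. by rewrite fd_blockM mul_delta_mx. Qed.

Fact min_proj_subproof j : is_projmx (const_mx (min_proj j) : 'M[A]_1).
Proof.
apply/andP; split; apply/eqP/matrixP => a b; rewrite !mxE.
  by rewrite big_ord1 !mxE min_proj_idem.
rewrite star_fd_block; congr fd_block.
by apply/matrixP => c d; rewrite !mxE conjC_nat andbC.
Qed.

Lemma K0_dim_min_proj j :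
  K0_dim (groth (mvn_class (mkproj (min_proj_subproof j)), 0)) = delta_mx j 0.
Proof.
rewrite K0_dimE raddf0 subr0 mvn_dimE; apply/matrixP => i c.
rewrite !mxE ord1 eqxx andbT natz; congr Posz; apply/eqP; rewrite -(eqr_nat C).
by rewrite pdim_trace big_ord1 mxE min_proj_trace.
Qed.

(** The classes of the minimal projections map to the standard basis of Z^k. *)
Lemma K0_dim_surj (v : 'cV[int]_k) : exists X : K0 A, K0_dim X = v.
Proof.
exists (\sum_j groth (mvn_class (mkproj (min_proj_subproof j)), 0) *~ v j 0).
rewrite raddf_sum [RHS]matrix_sum_delta; apply: eq_bigr => j _.
rewrite big_ord1 raddfMz /= K0_dim_min_proj.
by rewrite -[X in _ = X *: _]intz scaler_int.
Qed.

End Blocks.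

Lemma mxtrace_castmx (R : pzSemiRingType) N N' (e : N = N') (X : 'M[R]_N) :
  \tr (castmx (e, e) X) = \tr X.
Proof. by case: N' / e; rewrite castmx_id. Qed.

(* The identity [tr Q * QXQ = tr (XQ) * Q], summed over the matrix units [X],
   gives [(tr Q)^3 = tr Q]. *)
Lemma corner_trace (C : fieldType) N (Q : 'M[C]_N) :
    Q *m Q = Q -> (forall X, exists c, Q *m X *m Q = c *: Q) ->
  \tr Q != 0 -> \tr Q ^+ 2 = 1.
Proof.
move=> QQ cornerQ trQ.
have e X : \tr Q *: (Q *m X *m Q) = \tr (X *m Q) *: Q.
  have [c ec] := cornerQ X; rewrite ec.
  have -> : \tr (X *m Q) = c * \tr Q.
    by rewrite -mxtraceZ -ec [RHS]mxtrace_mulC mulmxA QQ mxtrace_mulC.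
  by rewrite scalerA mulrC.
(* This is entry [(a, b)] of [e] for the matrix unit [X = delta_mx a b]. *)
have e1 a b : \tr Q * (Q a a * Q b b) = Q b a * Q a b.
  have /matrixP/(_ a b) := e (delta_mx a b).
  have -> : Q *m delta_mx a b *m Q = col a Q *m row b Q.
    by rewrite -(mul_delta_mx (0 : 'I_1)) mulmxA -colE -mulmxA -rowE.
  have -> : \tr (delta_mx a b *m Q) = Q b a.
    rewrite -(mul_delta_mx (0 : 'I_1)) -mulmxA mxtrace_mulC -rowE -colE.
    by rewrite trace_mx11 !mxE.
  by rewrite !mxE big_ord1 !mxE.
apply: (mulfI trQ); rewrite mulr1; transitivity (\sum_a \sum_b Q a b * Q b a).
  rewrite expr2 big_distrlr mulr_sumr; apply: eq_bigr => a _.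
  by rewrite mulr_sumr; apply: eq_bigr => b _; rewrite e1 mulrC.
by rewrite -[in RHS]QQ; apply: eq_bigr => a _; rewrite mxE.
Qed.

(** * The trace formula, and K_0(phi) as multiplication by [E] *)

Section Multiplicity.
Variables (C : numClosedFieldType) (k l : nat).
Variables (n : 'I_k -> nat) (m : 'I_l -> nat).
Variables (phi : starHom C n m) (E : 'M[nat]_(l, k)).
Local Notation A := (fdalg C n).
Local Notation B := (fdalg C m).

Lemma mxtrace_multdiag (a : 'I_k -> nat) s (u : A) :
  \tr (multdiag a s u) = \sum_j (a j)%:R * \tr (u j).
Proof.
rewrite mxtrace_block mxtrace0 addr0 mxtrace_mxdiag; apply: eq_bigr => j _.
by rewrite mxtrace_mxdiag sumr_const card_ord mulr_natl.
Qed.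

Lemma starhomB (x y : A) : phi (x - y) = phi x - phi y.
Proof.
apply/eqP; rewrite eq_sym subr_eq; apply/eqP.
by rewrite -starhomD subrK.
Qed.

Hypothesis phiE : is_multiplicity_matrix phi E.

(** Conjugation by the unitary [nu] leaves the trace unchanged, so it can be read off the block
    diagonal form. *)
Lemma mxtrace_starhom (u : A) i :
  \tr (phi u i) = \sum_j (E i j)%:R * \tr (u j).
Proof.
have [nu [s [es [_ nuK h]]]] := phiE.
rewrite -(mxtrace_multdiag _ (s i)) -(mxtrace_castmx (es i)) -h.
by rewrite mxtrace_mulC mulmxA -fdM nuK fd1 mul1mx.
Qed.

Lemma pdim_proj_map (p : proj A) i :
  pdim (proj_map phi p) i = (\sum_j E i j * pdim p j)%N.
Proof.
apply/eqP; rewrite -(eqr_nat C) pdim_trace natr_sum; apply/eqP.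
transitivity (\sum_(a < psize p) \tr (phi (pmx p a a) i)).
  by apply: eq_bigr => a _; congr (\tr ((_ : B) i)); exact: mxE.
apply: etrans; first by apply: eq_bigr => a _; exact: mxtrace_starhom.
rewrite exchange_big; apply: eq_bigr => j _ /=.
by rewrite natrM pdim_trace mulr_sumr.
Qed.

Lemma K0_dim_map (X : K0 A) :
  K0_dim (K0_map phi X) = map_mx Posz E *m K0_dim X.
Proof.
have dimM x : mvn_dim (mvn_map phi x) = map_mx Posz E *m mvn_dim x.
  rewrite -(mvn_class_repr x) mvn_mapE !mvn_dimE.
  apply/matrixP => i c; rewrite !mxE pdim_proj_map.
  rewrite (big_morph Posz PoszD erefl).
  by apply: eq_bigr => j _; rewrite !mxE PoszM.
rewrite -(groth_repr X); case: (repr X) => x y.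
by rewrite /K0_map groth_mapE !K0_dimE mulmxBr -!dimM.
Qed.

Hypothesis n_gt0 : forall j, (0 < n j)%N.

Lemma K0_map_injective : injective (K0_map phi) <->
  (forall v : 'cV[int]_k, map_mx Posz E *m v = 0 -> v = 0).
Proof.
split=> [inj v|inj].
  have [X <-] := K0_dim_surj C n_gt0 v.
  rewrite -K0_dim_map => e; suff -> : X = 0 by rewrite raddf0.
  by apply: inj; apply: K0_dim_inj; rewrite e raddf0 raddf0.
apply: raddf_inj => X e; apply: K0_dim_inj; rewrite raddf0; apply: inj.
by rewrite -K0_dim_map /= e raddf0.
Qed.

(** A zero column [j] would put the basis vector [delta_mx j 0] in the kernel. *)
Lemma multiplicity_col_neq0 j :
    (forall v : 'cV[int]_k, map_mx Posz E *m v = 0 -> v = 0) ->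
  exists i, E i j != 0%N.
Proof.
move=> inj; apply/existsP; apply: contraT; rewrite negb_exists => /forallP E0.
have Ej0 : map_mx Posz E *m delta_mx j (0 : 'I_1) = 0.
  apply/matrixP => i c; rewrite -colE !mxE.
  by have := E0 i; rewrite negbK => /eqP ->.
by have /matrixP/(_ j 0) := inj _ Ej0; rewrite !mxE !eqxx.
Qed.

(** If [phi u = 0], the trace formula for the product of [u] with the matrix unit [(b, a)] of
    summand [j] reads [0 = E i j * u j a b]; choosing [i] with [E i j] nonzero kills every entry of
    [u]. *)
Lemma starhom_injective :
    (forall j, exists i, E i j != 0%N) -> injective phi.
Proof.
move=> E0 x y exy; apply/eqP; rewrite -subr_eq0; apply/eqP.
have : phi (x - y) = 0 by rewrite starhomB exy subrr.
move: (x - y) => u phiu0 {x y exy}; apply/fdP => j; rewrite fd0.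
have [i Eij] := E0 j; apply/matrixP => a b; rewrite [RHS]mxE.
have := mxtrace_starhom (fd_block (delta_mx b a : 'M[C]_(n j)) * u) i.
rewrite starhomM phiu0 mulr0 fd0 mxtrace0 (bigD1 j) //=.
rewrite big1 ?addr0 => [|j' j'j]; last first.
  by rewrite fd_blockMr fd_block_neq // mxtrace0 mulr0.
rewrite fd_blockMr fd_block_id => /esym/eqP.
rewrite mulf_eq0 pnatr_eq0 (negPf Eij) /=.
rewrite -(mul_delta_mx (0 : 'I_1)) -mulmxA mxtrace_mulC -rowE -colE.
by rewrite trace_mx11 !mxE => /eqP.
Qed.

Lemma K0_map_surjective :
    (forall v : 'cV[int]_l, exists w : 'cV[int]_k, map_mx Posz E *m w = v) ->
  forall Y, exists X, K0_map phi X = Y.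
Proof.
move=> surj Y; have [w Ew] := surj (K0_dim Y).
have [X eX] := K0_dim_surj C n_gt0 w.
by exists X; apply: K0_dim_inj; rewrite K0_dim_map eX.
Qed.

(** * Columns and rows of [E] when [phi] is onto *)

Hypothesis m_gt0 : forall i, (0 < m i)%N.
Hypothesis phi_surj : forall b, exists a, phi a = b.

Lemma corner_min_proj j (b : B) :
  exists c : C, phi (min_proj C n_gt0 j) * b * phi (min_proj C n_gt0 j)
                = c *: phi (min_proj C n_gt0 j).
Proof.
have [u <-] := phi_surj b.
by rewrite -!starhomM min_projMM starhomZ; eexists.
Qed.

Lemma mxtrace_min_proj i j : \tr (phi (min_proj C n_gt0 j) i) = (E i j)%:R.
Proof.
rewrite mxtrace_starhom (bigD1 j) //= min_proj_trace eqxx mulr1 big1 ?addr0 //.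
by move=> j' /negPf j'j; rewrite min_proj_trace j'j mulr0.
Qed.

(** The idempotent [Q] has trace [E i j] and a scalar corner, so [corner_trace] gives
    [E i j ^ 2 = 1]. *)
Lemma multiplicity_eq1 i j : E i j != 0%N -> E i j = 1%N.
Proof.
move=> Eij; pose Q := phi (min_proj C n_gt0 j) i.
have QQ : Q *m Q = Q by rewrite -fdM -starhomM min_proj_idem.
have cornerQ X : exists c, Q *m X *m Q = c *: Q.
  have [c /(congr1 (fun x : B => x i))] := corner_min_proj j (fd_block X).
  by rewrite !fdM fdZ fd_block_id => e; exists c.
have := corner_trace QQ cornerQ; rewrite mxtrace_min_proj pnatr_eq0.
by move/(_ Eij)/eqP; rewrite -natrX pnatr_eq1 -(exp1n 2) eqn_sqr => /eqP.
Qed.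

(** Compress the unit of summand [i] to the corner of [phi (min_proj j)]: the result is [c] times
    that projection. Traces in coordinate [i] give [c = 1], those in coordinate [i'] give
    [0 = c * E i' j]. *)
Lemma multiplicity_col_uniq i i' j :
  E i j != 0%N -> E i' j != 0%N -> i = i'.
Proof.
move=> Eij Ei'j; apply/eqP/contraT => ii'.
have [c e] := corner_min_proj j (fd_block (1%:M : 'M_(m i))).
have := congr1 (fun x : B => \tr (x i')) e.
have := congr1 (fun x : B => \tr (x i)) e.
rewrite !fdM !fdZ fd_block_id fd_block_neq 1?eq_sym // mulmx0 mul0mx mxtrace0.
rewrite mulmx1 -fdM -starhomM min_proj_idem !mxtraceZ !mxtrace_min_proj.
rewrite -{1}[(E i j)%:R]mul1r => /mulIf <-; last by rewrite pnatr_eq0.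
by rewrite mul1r => /esym/eqP; rewrite pnatr_eq0 (negPf Ei'j).
Qed.

(** With a zero row [i], coordinate [i] of every [phi u] has trace 0, but a minimal projection of
    summand [i] has trace 1. *)
Lemma multiplicity_row_neq0 i : exists j, E i j != 0%N.
Proof.
apply/existsP; apply: contraT; rewrite negb_exists => /forallP E0.
have [u eu] := phi_surj (min_proj C m_gt0 i).
have := mxtrace_starhom u i; rewrite eu min_proj_trace eqxx big1.
  by move/eqP; rewrite oner_eq0.
by move=> j _; have := E0 j; rewrite negbK => /eqP ->; rewrite mul0r.
Qed.

Lemma multiplicity_surjective (v : 'cV[int]_l) :
  exists w : 'cV[int]_k, map_mx Posz E *m w = v.
Proof.
have [s Es] := boolp.choice multiplicity_row_neq0.
(* Column [s i] of [E] is the standard basis vector of index [i]. *)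
exists (\sum_i v i 0 *: delta_mx (s i) 0); rewrite mulmx_sumr.
rewrite [RHS]matrix_sum_delta; apply: eq_bigr => i _.
rewrite big_ord1 -scalemxAr -colE; congr (_ *: _); apply/matrixP => i' c.
rewrite !mxE ord1 eqxx andbT; have [->|i'i] := eqVneq i' i.
  by rewrite multiplicity_eq1.
have [->//|Ei'] := eqVneq (E i' (s i)) 0%N.
by rewrite (multiplicity_col_uniq Ei' (Es i)) eqxx in i'i.
Qed.

End Multiplicity.

(** * Smith normal form and left inverses of injective integer matrices *)

Section InjectiveIntegerMatrix.
Variables (l k : nat) (E : 'M[int]_(l, k)).

Hypothesis E_inj : forall v : 'cV[int]_k, E *m v = 0 -> v = 0.

Definition smith_diag (d : seq int) : 'M[int]_(l, k) :=
  \matrix_(i, j) (d`_i *+ (i == j :> nat)).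

Lemma smith_diag_delta d j :
  smith_diag d *m delta_mx j (0 : 'I_1) = \col_i (d`_j *+ (i == j :> nat)).
Proof. by apply/matrixP => i c; rewrite -colE !mxE; case: eqP => // ->. Qed.

(** The diagonal factor inherits injectivity, so none of its columns vanishes. *)
Lemma injective_Smith :
  (k <= l)%N /\ exists (L : 'M[int]_l) (R : 'M[int]_k) (d : seq int),
    [/\ L \in unitmx, R \in unitmx, forall j : 'I_k, d`_j != 0
      & E = L *m smith_diag d *m R].
Proof.
have [L Lu [R Ru [d _]]] := int_Smith_normal_form E.
rewrite -/(smith_diag d) => eE.
have D_inj j : smith_diag d *m delta_mx j (0 : 'I_1) != 0.
  apply/eqP => Dj; have /E_inj : E *m (invmx R *m delta_mx j (0 : 'I_1)) = 0.
    by rewrite eE -!mulmxA mulKVmx // Dj mulmx0.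
  move/(congr1 (mulmx R)); rewrite mulKVmx // mulmx0 => /matrixP/(_ j 0).
  by rewrite !mxE !eqxx.
split; last first.
  exists L, R, d; split=> // j; apply: contraNneq (D_inj j) => dj0.
  rewrite smith_diag_delta dj0; apply/eqP/matrixP => i c.
  by rewrite !mxE mul0rn.
(* If [l < k], the column of index [l] has no diagonal entry and is zero. *)
case: leqP => // lt; have /eqP[] := D_inj (Ordinal lt).
by rewrite smith_diag_delta; apply/matrixP => i c; rewrite !mxE /= ltn_eqF.
Qed.

(** Purity of the image passes to the diagonal factor [D], where it makes each diagonal entry a
    unit; inverting these entries gives a left inverse of [D], hence of [E]. *)
Lemma left_inverse_of_pure :
    (forall (y : 'cV[int]_l) (N : nat) x, (0 < N)%N -> E *m x = y *+ N ->
       exists x', E *m x' = y) ->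
  exists K : 'M[int]_(k, l), K *m E = 1%:M.
Proof.
move=> pure; have [lekl [L [R [d [Lu Ru d0 eE]]]]] := injective_Smith.
set D := smith_diag d in eE.
have D_pure (y : 'cV[int]_l) (N : nat) x :
    (0 < N)%N -> D *m x = y *+ N -> exists x', D *m x' = y.
  move=> N0 e; have [|x' ex'] := pure (L *m y) N (invmx R *m x) N0.
    by rewrite eE -!mulmxA mulKVmx // e raddfMn.
  exists (R *m x'); move/(congr1 (mulmx (invmx L))): ex'.
  by rewrite eE -!mulmxA !mulKmx.
have d1 (j : 'I_k) : d`_j \is a GRing.unit.
  (* The multiplier must be a positive natural number: it is the absolute value of the diagonal
     entry, and the sign goes into the preimage. *)
  have [||x' ex'] := D_pure (delta_mx (widen_ord lekl j) 0) (absz d`_j)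
    (sgz d`_j *: delta_mx j 0).
  - by rewrite absz_gt0.
  - rewrite -scalemxAr smith_diag_delta; apply/matrixP => i c.
    rewrite mxE mulmxnE !mxE ord1.
    by rewrite andbT mulrnAr mulrnAC natz abszEsg.
  suff e : d`_j * x' j 0 = 1 by apply/unitrP; exists (x' j 0); rewrite mulrC e.
  have /matrixP/(_ (widen_ord lekl j) 0) := ex'; rewrite !mxE !eqxx.
  rewrite (bigD1 j) //= mxE eqxx big1 ?addr0 // => j' j'j.
  by rewrite mxE /= eq_sym val_eqE (negPf j'j) mul0r.
pose D' := \matrix_(j < k, i < l) ((d`_j)^-1 *+ (i == j :> nat)).
have D'D : D' *m D = 1%:M.
  apply/matrixP => j j'; rewrite mxE (bigD1 (widen_ord lekl j)) //= !mxE eqxx.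
  rewrite big1 ?addr0 => [|i ij].
    rewrite mulrnAr; have [->|jj'] := eqVneq j j'.
      by rewrite eqxx mulVr.
    by rewrite (negPf jj' : (_ == _ :> nat) = _).
  by rewrite !mxE (negPf ij : (_ == _ :> nat) = _) mul0r.
exists (invmx R *m D' *m invmx L).
by rewrite eE !mulmxA mulmxKV // -(mulmxA _ _ D) D'D mulmx1 mulVmx.
Qed.

End InjectiveIntegerMatrix.

(** Applying [K] to [E x = N y] gives [x = N K y], so [N E K y = N y], and [N] cancels. *)
Lemma left_inverse_pure l k (E : 'M[int]_(l, k)) (K : 'M[int]_(k, l)) :
    K *m E = 1%:M ->
  forall (y : 'cV[int]_l) (N : nat) x, (0 < N)%N -> E *m x = y *+ N ->
    exists x', E *m x' = y.
Proof.
move=> KE y N x N0 e; exists (K *m y).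
have := congr1 (mulmx K) e; rewrite mulmxA KE mul1mx raddfMn /= => xE.
move: e; rewrite xE raddfMn /= => e.
apply/matrixP => i c; apply: (@pmulrnI _ N N0).
by rewrite -!mulmxnE e.
Qed.

(** * The gcd of the full minors *)

Lemma dvdz_biggcd (I : eqType) (r : seq I) (P : pred I) (F : I -> int) i :
  i \in r -> P i -> (\big[gcdz/0]_(j <- r | P j) F j %| F i)%Z.
Proof.
elim: r => // j r IHr; rewrite inE big_cons => /predU1P[->|ir] Pi.
  by rewrite Pi dvdz_gcdl.
case: ifP => _; last exact: IHr.
by rewrite (dvdz_trans (dvdz_gcdr _ _)) ?IHr.
Qed.

Lemma increasingP r n (f : {ffun 'I_r -> 'I_n}) :
  reflect {homo f : a b / (a < b)%N} (increasing f).
Proof.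
apply: (iffP forallP) => [h a b ab|h a].
  by have /forallP/(_ b) := h a; rewrite ab.
by apply/forallP => b; apply/implyP/h.
Qed.

(** Used when [k <= l]: all columns are then selected, in order. Each step raises [f] by at least 1;
    counting steps from the first index gives [a <= f a], and counting up to the last gives
    [f a <= a]. *)
Lemma increasing_endo n (f : {ffun 'I_n -> 'I_n}) :
  increasing f -> f = finfun id.
Proof.
move=> /increasingP incf; apply/ffunP => a; rewrite ffunE; apply: val_inj => /=.
case: n => [|n] in f incf a *; first by case: a.
have gap (b : 'I_n.+1) (c : nat) (bc : (b + c < n.+1)%N) :
    (f b + c <= f (Ordinal bc))%N.
  elim: c => [|c IHc] in bc *.
    by rewrite addn0 (_ : Ordinal _ = b) //; apply: val_inj; rewrite /= addn0.
  have bc' : (b + c < n.+1)%N by rewrite (leq_trans _ bc) // addnS.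
  rewrite addnS; apply: leq_ltn_trans (IHc bc') _.
  by apply: incf; rewrite /= addnS.
apply/eqP; rewrite eqn_leq; apply/andP; split.
  have lt : (a + (n - a) < n.+1)%N by rewrite subnKC // -ltnS.
  have := leq_trans (gap a (n - a)%N lt) (leq_ord _).
  by rewrite -[leqRHS](subnKC (leq_ord a)) leq_add2r.
have lt : ((@ord0 n) + a < n.+1)%N by rewrite add0n.
have := gap ord0 a lt; rewrite (_ : Ordinal lt = a); last exact: val_inj.
exact: leq_trans (leq_addl _ _).
Qed.

Lemma dvd_full_minors_gcd l k (E : 'M[int]_(l, k)) (f : {ffun 'I_k -> 'I_l}) :
  (k <= l)%N -> increasing f -> (full_minors_gcd E %| \det (rowsub f E))%Z.
Proof.
rewrite /full_minors_gcd => /minn_idPl.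
(* The size [minn k l] occurs in the index types; generalizing it allows replacing it by [k]. *)
move: (minn k l) => r rk; subst r => incf.
apply: dvdz_trans (dvdz_biggcd _ (mem_index_enum f) incf) _.
have inc1 : increasing [ffun i : 'I_k => i].
  by apply/increasingP => a b; rewrite !ffunE.
apply: dvdz_trans (dvdz_biggcd _ (mem_index_enum _) inc1) _.
suff -> : mxsub f [ffun i => i] E = rowsub f E by [].
by apply/matrixP => i j; rewrite !mxE ffunE.
Qed.

Lemma full_minors_gcd_ge0 l k (E : 'M[int]_(l, k)) : 0 <= full_minors_gcd E.
Proof. exact: (big_rec (fun x : int => 0 <= x)). Qed.

(** The integers [d] for which [K E = d I] is solvable include 0, are closed under gcd by Bezout,
    and include each full minor through the adjugate of its submatrix. *)
Lemma full_minors_gcd_mx l k (E : 'M[int]_(l, k)) : (k <= l)%N ->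
  exists K : 'M[int]_(k, l), K *m E = (full_minors_gcd E)%:M.
Proof.
rewrite /full_minors_gcd => /minn_idPl; move: (minn k l) => r rk; subst r.
pose P d := exists K : 'M[int]_(k, l), K *m E = d%:M.
have P0 : P 0 by exists 0; rewrite mul0mx raddf0.
have Pgcd a b : P a -> P b -> P (gcdz a b).
  move=> [K Ka] [L Lb]; have [u [v <-]] := Bezoutz a b.
  exists (u *: K + v *: L).
  by rewrite mulmxDl -!scalemxAl Ka Lb !scale_scalar_mx raddfD.
rewrite -/(P _); apply: (big_ind P) => // f _; apply: (big_ind P) => // g.
move=> /increasing_endo ->; exists (\adj (rowsub f E) *m rowsub f 1%:M).
rewrite -mulmxA -rowsubE mul_adj_mx; congr (\det _)%:M.
by apply/matrixP => i j; rewrite !mxE ffunE.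
Qed.

(** Sorting the values of [f] gives [g]; they are distinct, so the order is strict. *)
Lemma increasing_row_selection l k (f : 'I_k -> 'I_l) : injective f ->
  exists2 g : {ffun 'I_k -> 'I_l}, increasing g &
    exists s : 'S_k, forall i, f i = g (s i).
Proof.
move=> injf.
pose t := [tuple f i | i < k].
have ut : uniq t by rewrite /= map_inj_uniq ?enum_uniq.
pose t' := [tuple of sort (fun a b : 'I_l => (a <= b)%N) t].
have st' : sorted (fun a b : 'I_l => (a < b)%N) t'.
  rewrite -[sorted _ _]/(sorted (relpre val ltn) t') -sorted_map.
  rewrite ltn_sorted_uniq_leq (map_inj_uniq val_inj).
  by rewrite sort_uniq ut sorted_map sort_sorted // => a b; exact: leq_total.
exists [ffun i => tnth t' i].
  apply/increasingP => a b ab; rewrite !ffunE !(tnth_nth (f a)).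
  apply: (sorted_ltn_nth _ _ st') => //; rewrite ?inE ?size_tuple //.
  by move=> ? ? ?; exact: ltn_trans.
have /tuple_permP[s es] : perm_eq t t' by rewrite perm_sym perm_sort.
exists s => i; rewrite ffunE.
have -> : f i = tnth t i by rewrite tnth_mktuple.
have -> : t = [tuple tnth t' (s i)  | i < k] by exact: val_inj.
by rewrite tnth_mktuple.
Qed.

(** A left inverse forces full column rank, so some [k] rows form an invertible matrix; putting them
    in increasing order only multiplies it by a permutation matrix. *)
Lemma unit_minor (F : fieldType) l k (E : 'M[F]_(l, k)) K : K *m E = 1%:M ->
  exists2 f : {ffun 'I_k -> 'I_l}, increasing f & \det (rowsub f E) != 0.
Proof.
move=> KE.
have fullE : row_full E by apply/row_fullP; exists K.
have [g incg [s eg]] :=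
  increasing_row_selection (@fullrankfun_inj _ _ _ _ fullE).
exists g => //; have := fullrowsub_unit fullE.
rewrite unitmxE unitfE; apply: contra => /eqP dg0.
have -> : rowsub (fullrankfun fullE) E = row_perm s (rowsub g E).
  by apply/matrixP => i j; rewrite !mxE eg.
by rewrite row_permE det_mulmx dg0 mulr0.
Qed.

Lemma full_minors_gcd_eq1 l k (E : 'M[int]_(l, k)) (K : 'M[int]_(k, l)) :
  (k <= l)%N -> K *m E = 1%:M -> full_minors_gcd E = 1.
Proof.
move=> lekl KE; have := full_minors_gcd_ge0 E.
have := fun f => @dvd_full_minors_gcd _ _ E f lekl.
move: (full_minors_gcd E) => g gE g_ge0.
apply/eqP; apply: contraT => g1.
have [p pp pg] : exists2 p, prime p & (p%:Z %| g)%Z.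
  (* Every prime divides a zero gcd, so 2 serves in that case. *)
  exists (if g == 0 then 2%N else pdiv (absz g)).
    case: eqP => // /eqP gn0; rewrite pdiv_prime //.
    by case: (g) g_ge0 gn0 g1 => [[|[]]|].
  case: eqP => [->|_]; first exact: dvdz0.
  by rewrite dvdzE pdiv_dvd.
have redKE : map_mx (intr : int -> 'F_p) K *m map_mx intr E = 1%:M.
  by rewrite -map_mxM KE map_mx1.
have [f incf] := unit_minor redKE.
rewrite -map_mxsub det_map_mx -(dvdz_pcharf (pchar_Fp pp)).
by rewrite (dvdz_trans pg (gE f incf)).
Qed.

(** * Torsion in the cokernel of K_0(phi) *)

Section Cokernel.
Variables (C : numClosedFieldType) (k l : nat).
Variables (n : 'I_k -> nat) (m : 'I_l -> nat).
Variables (phi : starHom C n m) (E : 'M[nat]_(l, k)).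
Hypotheses (n_gt0 : forall j, (0 < n j)%N) (m_gt0 : forall i, (0 < m i)%N).
Hypothesis phiE : is_multiplicity_matrix phi E.

Local Open Scope quotient_scope.

Lemma pi_coker_eq0 (Y : K0 (fdalg C m)) :
  \pi_(K0_coker phi) Y = 0 <-> exists X, K0_map phi X = Y.
Proof.
rewrite -[0](raddf0 (\pi_(Quotient.quot (K0_image phi)))).
split=> [/eqP|h]; last apply/eqP; rewrite -Quotient.idealrBE subr0.
  by move/asboolP.
exact/asboolP.
Qed.

(** A class of the quotient is killed by [N] exactly when [N] times a representative lies in the
    image; rank vectors turn this into purity of the image of [E]. *)
Lemma torsion_free_coker :
  torsion_free (K0_coker phi) <->
  (forall (y : 'cV[int]_l) (N : nat) x, (0 < N)%N ->
     map_mx Posz E *m x = y *+ N -> exists x', map_mx Posz E *m x' = y).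
Proof.
split=> [tf y N x N0 e|pure N z N0].
  have [X eX] := K0_dim_surj C n_gt0 x; have [Y eY] := K0_dim_surj C m_gt0 y.
  have /pi_coker_eq0[X' eX'] : \pi_(K0_coker phi) Y = 0.
    apply: (tf N _ N0); rewrite -raddfMn; apply/pi_coker_eq0.
    exists X; apply: K0_dim_inj.
    by rewrite (K0_dim_map phiE) eX e raddfMn /= eY.
  by exists (K0_dim X'); rewrite -(K0_dim_map phiE) eX'.
rewrite -[z]reprK; move: (repr z) => Y; rewrite -raddfMn => /pi_coker_eq0[X eX].
have [|x' ex'] := pure (K0_dim Y) N (K0_dim X) N0.
  by rewrite -(K0_dim_map phiE) eX raddfMn.
have [X' eX'] := K0_dim_surj C n_gt0 x'.
apply/pi_coker_eq0; exists X'; apply: K0_dim_inj.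
by rewrite (K0_dim_map phiE) eX'.
Qed.

End Cokernel.

Local Open Scope complex_scope.

Theorem theorem1p3 (R : realType) (k l : nat)
    (n : 'I_k -> nat) (m : 'I_l -> nat)
    (hn : forall j, (0 < n j)%N) (hm : forall i, (0 < m i)%N)
    (phi : starHom R[i] n m)
    (E : 'M[nat]_(l, k)) (hE : is_multiplicity_matrix phi E) :
  [/\ injective (K0_map phi) -> injective phi,
      (forall b, exists a, phi a = b) -> (forall y, exists x, K0_map phi x = y)
    & injective (K0_map phi) ->
      [<-> torsion_free (K0_coker phi);
           full_minors_gcd (map_mx Posz E) = 1;
           exists K : 'M[int]_(k, l), K *m map_mx Posz E = 1%:M]].
Proof.
split=> [/(K0_map_injective hE hn) E_inj | phi_surj
        | /(K0_map_injective hE hn) E_inj].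
- by apply: (starhom_injective hE) => j; apply: multiplicity_col_neq0.
- apply: (K0_map_surjective hE hn) => v.
  exact: multiplicity_surjective hE hn hm phi_surj v.
(* Injectivity gives [k <= l], so the full square submatrices are [k] by [k]. *)
have [lekl _] := injective_Smith E_inj.
have [pure_of of_pure] := torsion_free_coker hn hm hE.
have [K_of gcd_of] : (full_minors_gcd (map_mx Posz E) = 1 <->
    exists K : 'M[int]_(k, l), K *m map_mx Posz E = 1%:M).
  split=> [g1 | [K KE]]; last exact: full_minors_gcd_eq1 KE.
  by have := full_minors_gcd_mx (map_mx Posz E) lekl; rewrite g1.
(* The implication from (1) to (2) passes through a left inverse; (2) to (3) is [K_of]. *)
tfae=> // [/pure_of/(left_inverse_of_pure E_inj)/gcd_of // | [K KE]].
by apply/of_pure; exact: left_inverse_pure KE.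
Qed.
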